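(* Consider an instance of the cake-cutting problem with $k$ players (with hungry and closed preferences, as described in the context), and let $1\le p,q\le k$ be integers. (1) For any subset $S$ of $p$ players, there is a division of the cake into $k$ pieces such that, no matter which $\lceil\frac{k-p}{p}\rceil$ pieces are removed, there is an envy-free assignment of $p$ of the remaining pieces to the $p$ players of $S$: each player of $S$ receives a distinct remaining piece which is one of her preferred pieces in the division (so the players of $S$ envy neither each other nor the removed pieces). (2) There is a division of the cake into $q$ pieces such that, no matter which $\lceil\frac{k-q}{q}\rceil$ players leave, there is an envy-free assignment of the $q$ pieces to some $q$ of the remaining players: the $q$ pieces are given to $q$ distinct remaining players, each receiving one of her preferred pieces in the division.
   Context: The cake is the segment $[0,1]$. A division of the cake into $n$ pieces is a partition of $[0,1]$ into $n$ intervals (pieces, numbered from left to right, possibly of length zero); whether endpoints belong to an interval does not matter, so a division into $n$ pieces is identified with the vector of piece lengths, a point of the standard simplex in $\mathbb{R}^n$. For each division, each player has a nonempty set of preferred pieces (she may prefer several). Hungry assumption: in any division, each player prefers at least one piece of positive length. Closed preferences assumption: if a player prefers the $j$-th piece in each division of a converging sequence of divisions (into the same number of pieces), she also prefers the $j$-th piece in the limit division. An assignment of pieces to players is envy-free if each player receives a piece she prefers (weakly) to all other pieces of the division, i.e., one of her preferred pieces. *)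

(* Defs.v *)
From HB Require Import structures.
From mathcomp Require Import all_boot all_order all_algebra.
From mathcomp Require Import all_classical all_reals all_analysis.
Set Implicit Arguments. Unset Strict Implicit. Unset Printing Implicit Defensive.
Import Order.TTheory GRing.Theory Num.Theory.
Import numFieldNormedType.Exports.
Local Open Scope classical_set_scope.
Local Open Scope ring_scope.

(* A division of [0,1] into n pieces (numbered left to right) is identified
   with the vector of piece lengths: a point of the standard simplex of R^n. *)
Definition division (R : realType) (n : nat) (x : 'I_n -> R) : Prop :=
  (forall j, 0 <= x j) /\ \sum_(j < n) x j = 1.

(* Preferences of k players: [pref n i x j] means that, in the division x
   into n pieces, player i prefers (weakly, among others) the j-th piece. *)
Definition preferences (R : realType) (k : nat) : Type :=
  forall n : nat, 'I_k -> ('I_n -> R) -> 'I_n -> Prop.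

Definition hungry (R : realType) (k : nat) (pref : preferences R k) : Prop :=
  forall (n : nat) (i : 'I_k) (x : 'I_n -> R),
    division x -> exists j : 'I_n, pref n i x j /\ 0 < x j.

Definition closed_pref (R : realType) (k : nat) (pref : preferences R k) : Prop :=
  forall (n : nat) (i : 'I_k) (xs : nat -> 'I_n -> R) (x : 'I_n -> R) (j : 'I_n),
    (forall m, division (xs m)) -> division x ->
    (forall j' : 'I_n, (fun m => xs m j') @ \oo --> x j') ->
    (forall m, pref n i (xs m) j) -> pref n i x j.

Definition ceil_div (a b : nat) : nat := ((a + b.-1) %/ b)%N.

(* Main.v *)
Require Import Defs.
From HB Require Import structures.
From mathcomp Require Import all_classical all_reals all_analysis.
From mathcomp Require Import all_boot all_order all_algebra.
From mathcomp Require Import zify lra.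
Import Order.TTheory GRing.Theory Num.Theory.

(** Fix players [S] and a number [n] of pieces.  The theorem follows from a
    fractional version: some division [x] admits weights [w i j >= 0], positive
    only if player [i] prefers piece [j] in [x], with [\sum_j w i j = 1] for every
    [i] in [S] and [\sum_(i in S) w i j = #|S| / n] for every [j].  Double counting
    then gives Hall's condition with a surplus that survives the removals.

    Relaxing "prefers" to "prefers in some division within [eps]" makes such
    weights continuous in [x], namely proportional over [j] to [x j] times the
    [eps]-nearness to the set of divisions where [i] prefers [j].  Only the column
    sums must be adjusted.  Label [x] by a piece whose column sum is at most the
    average [#|S| / n]: a limit of ever finer grids produces an [x] where each
    piece has a column sum at most the average or has length zero, hence column
    sum zero, so all column sums equal the average.  Finally let [eps] tend to 0.
    The grid step is Scarf's combinatorial lemma, which plays the part of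
    Sperner's lemma without a triangulation. *)

Set Implicit Arguments. Unset Strict Implicit. Unset Printing Implicit Defensive.

(** * Scarf's lemma *)

(** Deleting either point of a colliding pair leaves the image unchanged, now with as many values as
    points, so there is no other collision. This serves the minimum map in [fills_even] and the
    colour map in [scarf]. *)
Lemma unique_collision (A B : finType) (f : A -> B) (D : {set A}) :
  #|f @: D|.+1 = #|D| ->
  exists a b, [/\ a \in D, b \in D, a != b, f a = f b &
    {in D :\ a &, injective f} /\ {in D :\ b &, injective f}].
Proof.
move=> cD.
have inj_del x y : x \in D -> y \in D -> x != y -> f x = f y ->
    {in D :\ x &, injective f}.
  move=> xD yD nxy fxy; apply/imset_injP.
  have -> : f @: (D :\ x) = f @: D.
    apply/setP => z; apply/imsetP/imsetP => -[u uD ->].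
      by exists u => //; move: uD; rewrite !inE => /andP[].
    have [ux|nux] := eqVneq u x; last by exists u; rewrite // !inE nux.
    by exists y; rewrite ?ux // !inE eq_sym nxy.
  by move: cD; rewrite (cardsD1 x D) xD; lia.
have : ~~ [forall x in D, forall y in D, (f x == f y) ==> (x == y)].
  apply/negP => inj; suff: #|f @: D| = #|D| by lia.
  apply/card_in_imset => x y xD yD fxy; apply/eqP.
  by move/forall_inP/(_ _ xD)/forall_inP/(_ _ yD)/implyP: inj; apply; apply/eqP.
move=> /forall_inPn[a aD] /forall_inPn[b bD]; rewrite negb_imply => /andP[/eqP fab nab].
exists a, b; split=> //; split; [exact: (inj_del a b)|].
by apply: (inj_del b a); rewrite // eq_sym.
Qed.

Lemma odd_sum_even (J : finType) (P : pred J) (F : J -> nat) :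
  (forall j, P j -> ~~ odd (F j)) -> ~~ odd (\sum_(j | P j) F j).
Proof. by move=> h; elim/big_ind: _ => // x y; rewrite oddD => /negbTE-> /negbTE->.
Qed.

Section Scarf.
Variables (I V : finType) (rank : I -> V -> nat) (e : I -> V).
Hypothesis rank_inj : forall i, injective (rank i).
Hypothesis e_low : forall i v, rank i (e i) <= rank i v.
Hypothesis e_high : forall i j v, j != i -> v \notin codom e -> rank i v < rank i (e j).

(** The condition behind Scarf's primitive sets: no vertex lies strictly above the minimum of [F] in
    all the linear orders encoded by the injective ranks. *)
Definition dominant (F : {set V}) :=
  [forall y, exists i, forall v in F, rank i y <= rank i v].

Lemma dominantP (F : {set V}) :
  reflect (forall y, exists i, forall v, v \in F -> rank i y <= rank i v) (dominant F).
Proof.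
apply: (iffP forallP) => h y; have := h y.
  by move/existsP => [i /forall_inP]; exists i.
by case=> i hi; apply/existsP; exists i; apply/forall_inP.
Qed.

Lemma dominantS (E F : {set V}) : E \subset F -> dominant F -> dominant E.
Proof.
move=> /subsetP EF /dominantP dF; apply/dominantP => y.
by have [i hi] := dF y; exists i => v /EF; apply: hi.
Qed.

Definition fills (E : {set V}) := [set v | (v \notin E) && dominant (v |: E)].

(** Each [e i] with [i != i0] is least in its order, so only order [i0] can witness dominance at a
    non-artificial vertex. This forces the added vertex to be the largest non-artificial one in
    order [i0]. *)
Lemma fills_artificial (i0 : I) (x0 : V) : x0 \notin codom e ->
  #|fills (e @: [set~ i0])| = 1.
Proof.
move=> x0X; set E := e @: _.
have [z zX zmax] : exists2 z, z \notin codom e &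
    forall y, y \notin codom e -> rank i0 y <= rank i0 z.
  by case: (@arg_maxnP _ x0 [pred v | v \notin codom e] (rank i0) x0X) => z zX zmax; exists z.
have notE y : y \notin codom e -> y \notin E.
  by apply: contra => /imsetP[i _ ->]; apply: codom_f.
suff -> : fills E = [set z] by rewrite cards1.
apply/setP => v; rewrite !inE; apply/andP/eqP => [[vE /dominantP dv]|->].
  have dX y : y \notin codom e -> rank i0 y <= rank i0 v.
    move=> yX; have [i hi] := dv y.
    have [->|nii0] := eqVneq i0 i; first by apply: hi; rewrite !inE eqxx.
    have /hi : e i \in v |: E.
      by rewrite !inE; apply/orP; right; apply/imset_f; rewrite !inE eq_sym.
    have := e_low i y; rewrite leq_eqVlt => /orP[/eqP/rank_inj ey|]; last lia.
    by move: yX; rewrite -ey codom_f.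
  have vX : v \notin codom e.
    apply/negP => /codomP[j vj]; have [jj0|njj0] := eqVneq j i0.
      have := dX _ x0X; rewrite vj jj0 => le0.
      have /rank_inj x0e : rank i0 x0 = rank i0 (e i0).
        by apply/eqP; rewrite eqn_leq le0 e_low.
      by move: x0X; rewrite x0e codom_f.
    by case/negP: vE; rewrite vj; apply/imset_f; rewrite !inE.
  by apply/(@rank_inj i0)/eqP; rewrite eqn_leq dX // zmax.
split; first exact: notE.
apply/dominantP => y; have [/codomP[i ->]|yX] := boolP (y \in codom e).
  by exists i => w _; apply: e_low.
exists i0 => w; rewrite !inE => /orP[/eqP->|/imsetP[j]]; first exact: zmax.
by rewrite !inE => ji0 ->; apply/ltnW/e_high.
Qed.

(* Adding [v] to [E] must make the "minimum" map from [I] to the enlarged set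
   bijective, so [v] has to become the minimum of one of the two orders that
   share their minimum over [E]; each of these two orders admits exactly one such [v]. *)
Lemma fills_even (E : {set V}) (x0 : V) : #|E|.+1 = #|I| ->
  x0 \in E -> x0 \notin codom e -> ~~ odd #|fills E|.
Proof.
move=> cE x0E x0X.
have [->|[v0]] := set_0Vmem (fills E); first by rewrite cards0.
rewrite !inE => /andP[_ /(dominantS (subsetUr _ _)) domE].
pose m i := [arg min_(v < x0 in E) rank i v].
have mE i : m i \in E by rewrite /m; case: arg_minnP.
have mmin i v : v \in E -> rank i (m i) <= rank i v.
  by rewrite /m; case: arg_minnP => // u _ h /h.
(* Dominance at [y] in [E] yields an order with minimum [y]; by the cardinalities, [m] then has
   exactly one collision. *)
have m_img : m @: [set: I] = E.
  apply/setP => y; apply/imsetP/idP => [[i _ ->]//|yE].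
  have [i hi] := dominantP _ domE y; exists i => //.
  by apply: (@rank_inj i); apply/eqP; rewrite eqn_leq hi ?mE // mmin.
have cm : #|m @: [set: I]|.+1 = #|[set: I]| by rewrite m_img cardsT.
have [a [b [_ _ nab mab [injNa injNb]]]] := unique_collision cm.
have m_low i x : x \in E -> x \notin codom e -> forall j, j != i -> rank i (m i) < rank i (e j).
  move=> xE xX j ji; apply: leq_ltn_trans (mmin i x xE) _; exact: e_high.
have fillP s t : s != t -> m s = m t -> {in [set: I] :\ s &, injective m} ->
    exists v, [/\ v \notin E, dominant (v |: E), rank s v < rank s (m s),
      (forall i, i != s -> rank i (m i) < rank i v) &
      forall w, w \notin E -> dominant (w |: E) -> rank s w < rank s (m s) -> w = v].
  move=> nst mst injs.
  (* The candidates lie above the old minimum in every order but [s]; [e s] is one of them.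
     Dominance singles out the candidate that is largest in order [s]. *)
  pose Z := [pred y | [forall i, (i != s) ==> (rank i (m i) < rank i y)]].
  have ZP y : reflect (forall i, i != s -> rank i (m i) < rank i y) (Z y).
    by apply: (iffP forallP) => h i; [apply/implyP/h | apply/implyP/h].
  have Zs : Z (e s).
    by apply/ZP => i nis; apply: (m_low i x0) => //; rewrite eq_sym.
  case: (@arg_maxnP _ (e s) Z (rank s) Zs) => v /ZP vZ vmax0.
  have vmax w : Z w -> rank s w <= rank s v by move=> /vmax0.
  have Zlt y : Z y -> rank s y < rank s (m s).
    move=> /ZP yZ; have [i hi] := dominantP _ domE y.
    have is_ : i = s.
      by apply: contraTeq (hi _ (mE i)) => nis; rewrite -ltnNge yZ.
    have := hi _ (mE i); rewrite is_ leq_eqVlt => /orP[/eqP/rank_inj ym|//].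
    by have := yZ t; rewrite eq_sym nst => /(_ isT); rewrite -mst ym ltnn.
  have vlt := Zlt v (introT (ZP v) vZ).
  have vE : v \notin E.
    by apply: contraTN vlt => vE; rewrite -leqNgt mmin.
  (* If [w] were below [m i] in an order [i != s], then [m i] would be the minimum of [w |: E] in
     some order [l != s]; injectivity off [s] gives [l = i], where [w] is smaller. *)
  have wZ w : w \notin E -> dominant (w |: E) -> rank s w < rank s (m s) -> Z w.
    move=> wE /dominantP dw wlt; apply/ZP => i nis; rewrite ltnNge; apply/negP => wi.
    have ltwi : rank i w < rank i (m i).
      rewrite ltn_neqAle wi andbT; apply/eqP => /rank_inj wm.
      by rewrite wm mE in wE.
    have [l hl] := dw (m i).
    have lm : m l = m i.
      apply: (@rank_inj l); apply/eqP; rewrite eqn_leq mmin //=.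
      by apply: hl; rewrite !inE mE orbT.
    have lw : rank l (m l) <= rank l w by rewrite lm; apply: hl; rewrite !inE eqxx.
    have nls : l != s by apply: contraTneq lw => ->; rewrite -ltnNge.
    have li : l = i by apply: injs; rewrite ?inE ?nls ?nis.
    by move: lw; rewrite li leqNgt ltwi.
  exists v; split=> //.
    apply/dominantP => y.
    have [yZ|nyZ] := boolP (Z y).
      exists s => w; rewrite !inE => /orP[/eqP->|wE]; first exact: vmax.
      by apply: leq_trans (mmin s w wE); apply/ltnW/Zlt.
    move/forallPn: nyZ => [i]; rewrite negb_imply -leqNgt => /andP[nis yi].
    exists i => w; rewrite !inE => /orP[/eqP->|wE].
      by apply: leq_trans yi _; apply/ltnW/vZ.
    by apply: leq_trans yi _; apply: mmin.
  move=> w wE dw wlt; have Zw := wZ w wE dw wlt.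
  apply: (@rank_inj s); apply/eqP; rewrite eqn_leq (vmax w Zw) /=.
  have [i hi] := dominantP _ dw v.
  have [is_|nis] := eqVneq i s.
    by rewrite -is_; apply: hi; rewrite !inE eqxx.
  have := hi (m i); by rewrite !inE mE orbT leqNgt (vZ i nis) => /(_ isT).
have nba : b != a by rewrite eq_sym.
have [u [uE du ua ub uU]] := fillP a b nab mab injNa.
have [v [vE dv vb va vU]] := fillP b a nba (esym mab) injNb.
suff -> : fills E = [set u; v].
  rewrite cards2; suff -> : u != v by [].
  by apply/eqP => uv; have := va a nab; rewrite -uv ltnNge ltnW.
apply/setP => w; rewrite !inE; apply/andP/orP => [[wE dw]|[/eqP->|/eqP->]] //.
have [wa|aw] := ltnP (rank a w) (rank a (m a)); first by left; apply/eqP/uU.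
have [wb|bw] := ltnP (rank b w) (rank b (m b)); first by right; apply/eqP/vU.
have mw i : m i != w by apply: contraNneq wE => <-.
(* Otherwise [w] is the minimum of a third order [l], and [m l] must be the minimum of another order
   [h]: a second collision of [m]. *)
have [l hl] := dominantP _ dw w.
have wl : rank l w < rank l (m l).
  rewrite ltn_neqAle hl ?inE ?mE ?orbT // andbT.
  by apply/eqP => /rank_inj wm; move: (mw l); rewrite wm eqxx.
have nla : l != a by apply: contraTneq wl => ->; rewrite -leqNgt.
have nlb : l != b by apply: contraTneq wl => ->; rewrite -leqNgt.
have [h hh] := dominantP _ dw (m l).
have hm : m h = m l.
  apply: (@rank_inj h); apply/eqP; rewrite eqn_leq mmin //=.
  by apply: hh; rewrite !inE mE orbT.
have hw : rank h (m l) <= rank h w by apply: hh; rewrite !inE eqxx.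
have nhl : h != l by apply: contraTneq hw => ->; rewrite -ltnNge.
have [ha|nha] := eqVneq h a.
  have : b = l by apply: injNa; rewrite ?inE ?nba ?nla // -hm ha.
  by move=> bl; rewrite bl eqxx in nlb.
have : h = l by apply: injNa; rewrite ?inE ?nha ?nla.
by move=> hl'; rewrite hl' eqxx in nhl.
Qed.

(* Parity count of the pairs [(F, v)] where [F] is a dominant set of full size
   and [F :\ v] carries exactly the colours other than [i0]: a set [F] with all
   colours occurs once and any other [F] an even number of times, while
   [E = F :\ v] occurs an even number of times unless it is the artificial set
   [e @: [set~ i0]]. *)
Lemma scarf (c : V -> I) (i0 : I) (x0 : V) :
  (forall i, c (e i) = i) -> x0 \notin codom e ->
  exists F : {set V}, [/\ #|F| = #|I|, dominant F & c @: F = [set: I]].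
Proof.
move=> ce x0X.
pose room (F : {set V}) := (#|F| == #|I|) && dominant F.
pose almost (E : {set V}) := c @: E == [set~ i0].
pose N := \sum_(F | room F) #|[set v in F | almost (F :\ v)]|.
have NE : N = \sum_(E | almost E && (#|E|.+1 == #|I|)) #|fills E|.
  rewrite /N.
  under eq_bigr do rewrite -sum1dep_card.
  under [RHS]eq_bigr do rewrite -sum1dep_card.
  rewrite (exchange_big_dep xpredT) //= [RHS](exchange_big_dep xpredT) //=.
  apply: eq_bigr => v _.
  rewrite (reindex_onto (fun E => v |: E) (fun F => F :\ v)) /=; last first.
    by move=> F /andP[_ /andP[vF _]]; rewrite setD1K.
  apply: eq_bigl => E; rewrite !inE eqxx /=.
  have [vE|vE] := boolP (v \in E).
    rewrite /= andbF; apply/negP => /andP[_ /eqP EE].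
    by move: vE; rewrite -EE !inE eqxx.
  by rewrite (setU1K vE) eqxx andbT /room cardsU1 vE /= andbC andbA.
have oddN : odd N.
  rewrite NE (bigD1 (e @: [set~ i0])) /=; last first.
    rewrite (card_imset _ (can_inj ce)) cardsC1 /almost -imset_comp.
    rewrite (eq_imset _ (ce : c \o e =1 id)) imset_id eqxx /=.
    by rewrite prednK //; apply/card_gt0P; exists i0.
  rewrite oddD (@fills_artificial i0 x0) //=.
  apply: odd_sum_even => E /andP[/andP[/eqP aE /eqP cE] nE].
  have [/exists_inP[x xE xX]|/exists_inPn h] := boolP [exists x in E, x \notin codom e].
    exact: (@fills_even _ x).
  case/negP: nE; apply/eqP/setP => v; apply/idP/imsetP => [vE|[i]].
    have /codomP[i vi] := negPn (h v vE).
    by exists i => //; rewrite -aE; apply/imsetP; exists v; rewrite // vi ce.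
  rewrite -aE => /imsetP[w wE ->] ->.
  by have /codomP[j wj] := negPn (h w wE); rewrite wj ce -wj.
have [/existsP[F /and3P[/eqP cF dF /eqP iF]]|/existsPn noF] :=
  boolP [exists F : {set V}, [&& #|F| == #|I|, dominant F & c @: F == [set: I]]].
  by exists F.
suff: ~~ odd N by rewrite oddN.
apply: odd_sum_even => F /andP[/eqP cF dF].
have nF : c @: F != [set: I] by have := noF F; rewrite cF dF eqxx.
have [->|[v0]] := set_0Vmem [set v in F | almost (F :\ v)]; first by rewrite cards0.
rewrite inE => /andP[v0F /eqP av0].
(* All colours but [i0] survive the removal of [v0], and [F] lacks some colour, which must be [i0].
   So one colour occurs twice, and only its two carriers can be removed. *)
have cFE : c @: F = [set~ i0].
  have sub : [set~ i0] \subset c @: F by rewrite -av0 imsetS // subsetDl.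
  apply/eqP; rewrite eqEsubset sub andbT; apply/subsetP => i iF.
  rewrite !inE; apply: contraNneq nF => ii0; apply/eqP/setP => j; rewrite inE.
  have [->|nj] := eqVneq j i0; first by rewrite -ii0.
  by apply: (subsetP sub); rewrite !inE.
have I0 : 0 < #|I| by apply/card_gt0P; exists i0.
have [a [b [aF bF nab cab [injNa injNb]]]] : exists a b, [/\ a \in F, b \in F, a != b, c a = c b &
    {in F :\ a &, injective c} /\ {in F :\ b &, injective c}].
  by apply: unique_collision; rewrite cFE cardsC1 prednK.
suff -> : [set v in F | almost (F :\ v)] = [set a; b] by rewrite cards2 nab.
have del x y : x \in F -> y \in F -> x != y -> c x = c y -> almost (F :\ x).
  move=> xF yF nxy cxy; rewrite /almost -cFE; apply/eqP/setP => z.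
  apply/imsetP/imsetP => -[u uF ->]; first by exists u => //; move: uF; rewrite !inE => /andP[].
  have [->|nu] := eqVneq u x; last by exists u; rewrite // !inE nu.
  by exists y; rewrite // !inE eq_sym nxy.
apply/setP => v; rewrite !inE; apply/andP/orP => [[vF /eqP av]|[]/eqP->]; last 2 first.
- by split=> //; apply: del nab cab.
- by split=> //; apply: del (esym cab); rewrite // eq_sym.
have : c v \in c @: (F :\ v) by rewrite av -cFE imset_f.
move=> /imsetP[w]; rewrite !inE => /andP[nwv wF] cvw.
have [va|nva] := eqVneq v a; [by left|right].
have [wa|nwa] := eqVneq w a.
  have [//|nvb] := eqVneq v b.
  by move: nvb; rewrite (injNa v b) ?eqxx // ?inE ?nva ?vF ?bF 1?eq_sym ?nab // -cab cvw wa.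
by move: nwv; rewrite (injNa v w) ?eqxx // ?inE ?nva ?nwa ?vF ?wF.
Qed.

End Scarf.

(** * Fine grids in the simplex *)

Section Grid.
Variables (I : finType) (N : nat).

Definition grid := {x : {ffun I -> 'I_N.+1} | \sum_i (x i : nat) == N}.

Definition gval (x : grid) (i : I) : nat := val x i.

Lemma gval_sum (x : grid) : \sum_i gval x i = N.
Proof. exact/eqP/(valP x). Qed.

Lemma gridE (y : I -> nat) : \sum_i y i = N -> exists x : grid, gval x =1 y.
Proof.
move=> sy; have yN i : y i < N.+1 by rewrite ltnS -sy (bigD1 i) //= leq_addr.
pose f := [ffun i => Ordinal (yN i)].
have sf : \sum_i (f i : nat) == N.
  by rewrite -[X in _ == X]sy; apply/eqP/eq_bigr => i _; rewrite ffunE.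
by exists (Sub f sf) => i; rewrite /gval /= ffunE.
Qed.

(* Coordinate order with ties broken by [enum_rank]; the artificial point of [i]
   comes first in order [i] and after all grid points in the other orders. *)
Definition grid_rank (i : I) (v : grid + I) : nat :=
  match v with
  | inl x => (gval x i * #|{: grid}| + enum_rank x).+1
  | inr j => if j == i then 0 else (N.+1 * #|{: grid}| + enum_rank j).+1
  end.

Lemma grid_rank_lt (x : grid) i :
  gval x i * #|{: grid}| + enum_rank x < N.+1 * #|{: grid}|.
Proof.
have xN : gval x i <= N by rewrite -ltnS; apply: ltn_ord.
apply: (@leq_trans ((gval x i).+1 * #|{: grid}|)); last by rewrite leq_mul2r ltnS xN orbT.
by rewrite mulSn addnC ltn_add2r ltn_ord.
Qed.

Lemma grid_rank_inj i : injective (grid_rank i).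
Proof.
have K0 (x : grid) : 0 < #|{: grid}| by apply/card_gt0P; exists x.
move=> [x|j] [y|l] /=.
- move=> [] /(congr1 (modn^~ #|{: grid}|)).
  by rewrite !modnMDl !modn_small // => /val_inj/enum_rank_inj ->.
- case: eqP => // _ [] e; have := grid_rank_lt x i; by rewrite e ltnNge leq_addr.
- case: eqP => // _ [] e; have := grid_rank_lt y i; by rewrite -e ltnNge leq_addr.
case: eqP => [->|_]; first by case: eqP => [->|].
by case: eqP => // _ [] /addnI/val_inj/enum_rank_inj ->.
Qed.

Lemma grid_rank_le (x y : grid) i :
  grid_rank i (inl x) <= grid_rank i (inl y) -> gval x i <= gval y i.
Proof.
rewrite /= ltnS => le; rewrite leqNgt; apply/negP => lt.
have : (gval y i).+1 * #|{: grid}| <= gval x i * #|{: grid}| by rewrite leq_mul2r lt orbT.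
rewrite mulSn addnC => le2; have := ltn_ord (enum_rank y); rewrite ltnNge; case/negP.
by rewrite -(leq_add2l (gval y i * #|{: grid}|)) (leq_trans le2) // (leq_trans _ le) // leq_addr.
Qed.

(** [C] collects the colours whose artificial point is outside the set [F] given by [scarf]; these
    colours come from grid points of [F]. Dominance makes the minima [lo] over [C] add up to nearly
    [N], which keeps the grid points of [F] close together. *)
Lemma grid_labels (i0 : I) (c : grid -> I) :
  exists (C : {set I}) (x : grid),
    (forall l, l \notin C -> gval x l <= #|I|) /\
    (forall i, i \in C -> exists2 y : grid, c y = i &
       forall l, gval y l <= gval x l + #|I| /\ gval x l <= gval y l + #|I|).
Proof.
have [g0 _] : exists x : grid, gval x =1 (fun i => if i == i0 then N else 0).
  by apply: gridE; rewrite -big_mkcond big_pred1_eq.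
pose c' (v : grid + I) := match v with inl x => c x | inr i => i end.
have noinl (x : grid) : (inl x : grid + I) \notin codom inr by apply/codomP => -[].
have low i v : grid_rank i (inr i) <= grid_rank i v by rewrite /= eqxx.
have high i j v : j != i -> v \notin codom inr -> grid_rank i v < grid_rank i (inr j).
  case: v => [x|l]; last by rewrite codom_f.
  move=> /negbTE /= -> _; rewrite ltnS; apply: leq_trans (grid_rank_lt x i) _.
  exact: leq_addr.
have [F [cF /dominantP dF iF]] :=
  scarf grid_rank_inj low high i0 (c := c') (fun=> erefl) (noinl g0).
pose C := [set i | (inr i : grid + I) \notin F].
have dC (y : grid) : exists2 i, i \in C & forall x, inl x \in F -> gval y i <= gval x i.
  have [i hi] := dF (inl y); exists i; last by move=> x /hi/grid_rank_le.
  by rewrite inE; apply/negP => /hi; rewrite /= eqxx.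
have labC i : i \in C -> exists2 y : grid, inl y \in F & c y = i.
  rewrite inE => iC; have : i \in c' @: F by rewrite iF inE.
  case/imsetP => -[y|j] vF /= ij; first by exists y.
  by rewrite ij vF in iC.
have [i1 i1C _] := dC g0; have [x1 x1F _] := labC _ i1C.
pose s := [pred x : grid | inl x \in F].
pose lo i := gval [arg min_(x < x1 | s x) gval x i] i.
have lo_min i x : inl x \in F -> lo i <= gval x i.
  by rewrite /lo; case: arg_minnP => // u _ h /h.
have lo_at : forall i, exists2 x, inl x \in F & lo i = gval x i.
  by move=> i; rewrite /lo; case: arg_minnP => // u su _; exists u.
(* Otherwise the grid point with coordinates [(lo i).+1] on [C], the rest of [N] being put on [i1],
   would exceed every minimum over [C], against dominance. *)
have lo_sum : N < \sum_(i in C) (lo i).+1.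
  rewrite ltnNge; apply/negP => le.
  pose y i := if i \in C
    then (lo i).+1 + (if i == i1 then N - \sum_(i in C) (lo i).+1 else 0) else 0.
  have [g gy] : exists x : grid, gval x =1 y.
    apply: gridE; rewrite /y -big_mkcond big_split /=.
    by rewrite -big_mkcondr (big_pred1 i1) ?subnKC // => i; rewrite andb_idl // => /eqP->.
  have [i iC hi] := dC g; have [x xF lox] := lo_at i.
  by have := hi x xF; rewrite gy /y iC -lox; lia.
have cC : #|C| <= #|I| by apply: max_card.
(* The coordinates of [x] add up to [N] and are at least [lo] on [C], so less than [#|C|] is left to
   share. *)
have F_near x : inl x \in F -> (forall l, l \in C -> gval x l <= lo l + #|I|) /\
    (forall l, l \notin C -> gval x l <= #|I|).
  move=> xF; have := gval_sum x; rewrite (bigID (mem C)) /= => sx.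
  have sS : \sum_(i in C) (lo i).+1 = \sum_(i in C) lo i + #|C|.
    by under eq_bigr do rewrite -addn1; rewrite big_split /= sum1_card.
  split=> l lC.
    have : \sum_(i in C | i != l) lo i <= \sum_(i in C | i != l) gval x i.
      by apply: leq_sum => i _; apply: lo_min.
    move: sx lo_sum; rewrite sS (bigD1 l) //= [in X in _ < X](bigD1 l) //=.
    move: (gval x l) (\sum_(i in C | i != l) gval x i) (\sum_(i | i \notin C) gval x i).
    by move: (\sum_(i in C | i != l) lo i) (lo l) #|C| #|I| cC; clear=> *; lia.
  have : \sum_(i in C) lo i <= \sum_(i in C) gval x i.
    by apply: leq_sum => i _; apply: lo_min.
  move: sx lo_sum; rewrite sS (bigD1 (P := [predC C]) l) //=.
  move: (gval x l) (\sum_(i in C) gval x i) (\sum_(i in C) lo i) (\sum_(i | _) gval x i).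
  by move: #|C| #|I| cC; clear=> *; lia.
exists C, x1; split; first exact: (F_near x1 x1F).2.
move=> i iC; have [y yF cy] := labC i iC; exists y => // l.
have [lC|lC] := boolP (l \in C).
  have := (F_near x1 x1F).1 l lC; have := (F_near y yF).1 l lC.
  have := lo_min l x1 x1F; have := lo_min l y yF; lia.
have := (F_near x1 x1F).2 l lC; have := (F_near y yF).2 l lC; lia.
Qed.

End Grid.

(** * Hall's theorem with removals *)

Definition nbhd (T U : finType) (r : T -> U -> bool) (B : {set T}) : {set U} :=
  [set u | [exists t in B, r t u]].

Lemma nbhdU (T U : finType) (r : T -> U -> bool) (A B : {set T}) :
  nbhd r (A :|: B) = nbhd r A :|: nbhd r B.
Proof.
apply/setP => u; rewrite !inE; apply/exists_inP/orP => [[t]|].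
  by rewrite inE => /orP[] tX rtu; [left|right]; apply/exists_inP; exists t.
by case=> /exists_inP[t tX rtu]; exists t; rewrite // inE tX ?orbT.
Qed.

(* Either every proper nonempty subset has a surplus neighbour, and then any
   edge at a vertex may be matched first, or some proper subset [B] is tight,
   and then [B] and its complement are matched separately. *)
Lemma hall (T U : finType) (u0 : U) (r : T -> U -> bool) (A : {set T}) :
  (forall B : {set T}, B \subset A -> #|B| <= #|nbhd r B|) ->
  exists f : T -> U, {in A &, injective f} /\ forall t, t \in A -> r t (f t).
Proof.
have [n] := ubnP #|A|; elim: n r A => // n IH r A; rewrite ltnS => cA hA.
have [->|[a aA]] := set_0Vmem A.
  by exists (fun=> u0); split=> t; rewrite inE.
case: (boolP [exists B : {set T}, [&& B \proper A, B != set0 & #|nbhd r B| == #|B|]]).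
  move=> /existsP[B /and3P[pB B0 /eqP tB]].
  have sB := proper_sub pB; have ltB := proper_card pB.
  have [f1 [inj1 r1]] : exists f : T -> U, {in B &, injective f} /\ forall t, t \in B -> r t (f t).
    apply: IH; first exact: leq_trans ltB cA.
    by move=> D /subset_trans/(_ sB); apply: hA.
  pose r' t u := r t u && (u \notin nbhd r B).
  have [f2 [inj2 r2]] : exists f : T -> U, {in A :\: B &, injective f} /\
      forall t, t \in A :\: B -> r' t (f t).
    apply: IH.
      have := cardsID B A; rewrite (setIidPr sB); move: B0; rewrite -card_gt0; lia.
    move=> D sD; have DB : [disjoint B & D].
      by move: sD; rewrite subsetD disjoint_sym => /andP[].
    (* Subtracting the equality for the tight set [B] turns this into Hall's condition for [D] under
       [r']. *)
    have : #|B :|: D| <= #|nbhd r (B :|: D)|.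
      by apply: hA; rewrite subUset sB (subset_trans sD (subsetDl _ _)).
    have -> : nbhd r (B :|: D) = nbhd r B :|: nbhd r' D.
      rewrite nbhdU; apply/setP => u; rewrite [LHS]inE [RHS]inE.
      have [//|nu /=] := boolP (u \in nbhd r B); rewrite !inE.
      by apply: eq_existsb => t; rewrite /r' nu andbT.
    have -> : #|B :|: D| = #|B| + #|D| by rewrite cardsU (disjoint_setI0 DB) cards0 subn0.
    have := leq_card_setU (nbhd r B) (nbhd r' D); rewrite /= => -[le _]; lia.
  exists (fun t => if t \in B then f1 t else f2 t); split; last first.
    move=> t tA; case: ifP => tB'; first exact: r1.
    by have := r2 t; rewrite inE tB' tA => /(_ isT)/andP[].
  have no s t : s \in B -> t \in A -> t \notin B -> f1 s <> f2 t.
    move=> sB' tA tB' e; have := r2 t; rewrite inE tB' tA => /(_ isT)/andP[_].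
    by rewrite -e inE => /exists_inP[]; exists s; rewrite // r1.
  move=> s t sA tA /=; case: ifPn => sB'; case: ifPn => tB'.
  - exact: inj1.
  - by move/no => /(_ sB' tA tB').
  - by move/esym/no => /(_ tB' sA sB').
  - by apply: inj2; rewrite inE ?sB' ?tB'.
move/existsPn => surplus.
have : 0 < #|nbhd r [set a]| by apply: leq_trans (hA [set a] _); rewrite ?cards1 ?sub1set.
case/card_gt0P => b; rewrite inE => /exists_inP[_ /set1P-> rab].
(* Giving up [b] costs a set at most one neighbour, which the surplus pays for. *)
pose r' t u := r t u && (u != b).
have [f [injf rf]] : exists f : T -> U, {in A :\ a &, injective f} /\
    forall t, t \in A :\ a -> r' t (f t).
  apply: IH; first by move: cA; rewrite (cardsD1 a A) aA.
  move=> D sD; have [->|nD] := eqVneq D set0; first by rewrite cards0.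
  have pD : D \proper A := sub_proper_trans sD (properD1 aA).
  have := surplus D; rewrite pD nD /= => sur.
  have := hA D (proper_sub pD).
  have -> : nbhd r' D = nbhd r D :\ b.
    apply/setP => u; rewrite !inE; apply/exists_inP/andP.
      by move=> [t tD /andP[rtu nub]]; split=> //; apply/exists_inP; exists t.
    by move=> [nub /exists_inP[t tD rtu]]; exists t => //; rewrite /r' rtu.
  have := cardsD1 b (nbhd r D); move: sur; case: (b \in _) => /=; lia.
exists (fun t => if t == a then b else f t); split; last first.
  move=> t tA; case: eqP => [->//|/eqP ta].
  by have := rf t; rewrite !inE ta tA => /(_ isT)/andP[].
have no t : t \in A -> t != a -> b <> f t.
  by move=> tA ta e; have := rf t; rewrite !inE ta tA /r' -e eqxx andbF => /(_ isT).
move=> s t sA tA /=; case: ifPn => [/eqP->|sa]; case: ifPn => [/eqP->//|ta].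
- by move/no => /(_ tA ta).
- by move/esym/no => /(_ sA sa).
- by apply: injf; rewrite !inE ?sa ?ta.
Qed.

(* With [s = #|B|] and [N = #|nbhd r B|], the hypothesis [k s <= p N] gives
   [p (N - s) >= (k - p) s >= k - p], so [B] keeps at least [s] neighbours. *)
Lemma hall_robust (T U : finType) (u0 : U) (r : T -> U -> bool) (A : {set T})
    (p k : nat) (Rm : {set U}) : 0 < p <= k ->
  (forall B : {set T}, B \subset A -> k * #|B| <= p * #|nbhd r B|) ->
  #|Rm| = ceil_div (k - p) p ->
  exists f : T -> U, {in A &, injective f} /\
    forall t, t \in A -> f t \notin Rm /\ r t (f t).
Proof.
move=> /andP[p0 pk] hB cR.
have [|f [injf rf]] := @hall T U u0 (fun t u => r t u && (u \notin Rm)) A; last first.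
- by exists f; split=> // t /rf/andP[].
move=> B BA; have [->|/set0Pn[b bB]] := eqVneq B set0; first by rewrite cards0.
have -> : nbhd (fun t u => r t u && (u \notin Rm)) B = nbhd r B :\: Rm.
  apply/setP => u; rewrite !inE; have [uR|uR] := boolP (u \in Rm).
    by apply/exists_inP => -[t _]; rewrite andbF.
  by apply: eq_existsb => t; rewrite andbT.
have := hB B BA; have := cardsID Rm (nbhd r B).
have := subset_leq_card (subsetIr (nbhd r B) Rm); rewrite cR /ceil_div.
have : 0 < #|B| by apply/card_gt0P; exists b.
have [d ->] : exists d, k = p + d by exists (k - p); rewrite subnKC.
rewrite addKn; set N := #|nbhd r B|; set s := #|B|; set x := #|_ :\: _|; set y := #|_ :&: _|.
move=> s0 yr xy hs.
have ds : d <= p * (N - s).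
  have : s <= N by rewrite -(leq_pmul2l p0); nia.
  by move=> sN; rewrite mulnBr; nia.
have : (d + p.-1) %/ p <= N - s.
  by rewrite -ltnS ltn_divLR //; nia.
have : s <= N by rewrite -(leq_pmul2l p0); nia.
lia.
Qed.

(** * Limits of divisions *)

Import numFieldNormedType.Exports.

Section Analysis.
Local Open Scope classical_set_scope.
Local Open Scope ring_scope.

Lemma cvgr_sum (R : realType) (I : finType) (P : pred I) (u : I -> nat -> R) (l : I -> R) :
  (forall i, P i -> u i @ \oo --> l i) ->
  (fun m => \sum_(i | P i) u i m) @ \oo --> \sum_(i | P i) l i.
Proof. by apply: cvg_big; exact: add_continuous. Qed.

Section Divisions.
Variables (R : realType) (n : nat).
Implicit Types (x y : 'I_n -> R).

Lemma division_le1 x j : division x -> x j <= 1.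
Proof.
by move=> [x0 <-]; rewrite (bigD1 j) //= lerDl sumr_ge0.
Qed.

Definition dist1 x y : R := \sum_l `|x l - y l|.

Lemma dist1_coord x y j : `|x j - y j| <= dist1 x y.
Proof. by rewrite /dist1 (bigD1 j) //= lerDl sumr_ge0. Qed.

Lemma cvg_inv_bound (u : nat -> R) (l b : R) :
  (forall m, `|u m - l| <= b * m.+1%:R^-1) -> u @ \oo --> l.
Proof.
move=> hu; apply/subr_cvg0/norm_cvg0P.
have h0 : (fun m => b * m.+1%:R^-1 : R) @ \oo --> (0 : R).
  by rewrite -[X in _ --> X](mulr0 b); apply: cvgMr; exact: cvg_harmonic.
apply: (squeeze_cvgr _ (cvg_cst 0) h0).
by near=> m; rewrite normr_ge0 hu.
Unshelve. all: by end_near.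
Qed.

Lemma cvg_division (ys : nat -> 'I_n -> R) x :
  (forall m, division (ys m)) -> (forall j, (fun m => ys m j) @ \oo --> x j) -> division x.
Proof.
move=> dy yx; split=> [j|].
  by apply: (cvgr_to_ge (yx j)); near=> m; exact: (dy m).1.
have : (fun m => \sum_(j < n) ys m j) @ \oo --> \sum_(j < n) x j.
  by apply: (@cvgr_sum _ _ xpredT (fun j m => ys m j)) => j _; exact: yx.
under eq_fun do rewrite (dy _).2.
by move=> h; apply: (cvg_unique (@Rhausdorff R) h); exact: cvg_cst.
Unshelve. all: by end_near.
Qed.

Lemma division_limit_point (u : nat -> 'I_n -> R) :
  (forall m, division (u m)) ->
  exists x, forall m N, exists2 k, (N <= k)%N & forall j, `|u k j - x j| <= m.+1%:R^-1.
Proof.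
move=> du.
pose K := [set v : 'rV[R]_n | forall i, v ord0 i \in `[0, 1]].
have cK : compact K.
  apply: (@rV_compact R n (fun=> `[0, 1]%classic)) => _; exact: segment_compact.
pose v m : 'rV[R]_n := \row_j u m j.
have vK : (v @ \oo) K.
  exists 0%N => // m _ i /=; rewrite mxE in_itv /= division_le1 // andbT; exact: (du m).1.
have [w [_ cw]] := cK _ _ vK.
exists (w ord0) => m N.
have /cw : (v @ \oo) [set v k | k in [set k | (N <= k)%N]].
  by exists N => // k /= Nk; exists k.
have m0 : 0 < m.+1%:R^-1 :> R by [].
move=> /(_ _ (nbhsx_ballx w m.+1%:R^-1 m0)) [z [[k /= Nk <-] bz]].
exists k => // j; case: bz => _ /(_ ord0 j); rewrite mxE => /ltW.
by rewrite distrC.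
Qed.

(* Sequential compactness combined with the pigeonhole principle on [T]. *)
Lemma division_pigeonhole (T : finType) (Q : nat -> ('I_n -> R) -> T -> Prop) :
  (forall m m' x t, (m <= m')%N -> Q m' x t -> Q m x t) ->
  (forall m, exists x t, division x /\ Q m x t) ->
  exists x t (ys : nat -> 'I_n -> R),
    [/\ division x, forall m, division (ys m),
        forall m j, `|ys m j - x j| <= m.+1%:R^-1 & forall m, Q m (ys m) t].
Proof.
move=> Qmono Qex.
have [t ht] : exists t, forall m, exists x, division x /\ Q m x t.
  apply: contrapT => /forallNP h.
  have {}h t : exists m, forall x, division x -> ~ Q m x t.
    have /existsNP[m hm] := h t; exists m => x dx qx; apply: hm; by exists x.
  have /choice[f hf] := h.
  have [x [t [dx]]] := Qex (\max_t f t).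
  by move/(@Qmono (f t)) => qx; apply: (hf t x dx); apply: qx; apply: leq_bigmax.
have /choice[u hu] := ht.
have [x hx] := division_limit_point (fun m => (hu m).1).
have /choice[k hk] : forall m, exists k, (m <= k)%N /\ forall j, `|u k j - x j| <= m.+1%:R^-1.
  by move=> m; have [k] := hx m m; exists k.
exists x, t, (fun m => u (k m)); split.
- apply: (@cvg_division (fun m => u (k m))) => [m|j]; first exact: (hu _).1.
  by apply: (@cvg_inv_bound _ _ 1) => m; rewrite mul1r; apply: (hk m).2.
- by move=> m; exact: (hu _).1.
- by move=> m j; apply: (hk m).2.
- move=> m; apply: Qmono (hu (k m)).2; exact: (hk m).1.
Qed.

(** A KKM-type statement. Finer and finer grids provide label sets [C], one of which
    [division_pigeonhole] fixes: labels in [C] pass to the limit by closedness, and pieces outside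
    [C] shrink to length zero. *)
Lemma closed_labels (P : ('I_n -> R) -> 'I_n -> Prop) : (0 < n)%N ->
  (forall x, division x -> exists j, P x j) ->
  (forall (ys : nat -> 'I_n -> R) x j, (forall m, division (ys m)) -> division x ->
     (forall l, (fun m => ys m l) @ \oo --> x l) -> (forall m, P (ys m) j) -> P x j) ->
  exists x, division x /\ forall j, P x j \/ x j = 0.
Proof.
move=> n0 Pex Pcl.
pose Q m x (C : {set 'I_n}) :=
  (forall l, l \notin C -> x l <= n%:R * m.+1%:R^-1) /\
  forall i, i \in C -> exists2 y, division y /\ P y i & forall l, `|y l - x l| <= n%:R * m.+1%:R^-1.
have Qmono m m' x C : (m <= m')%N -> Q m' x C -> Q m x C.
  move=> mm' [Q1 Q2].
  have le : n%:R * m'.+1%:R^-1 <= n%:R * m.+1%:R^-1 :> R.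
    by rewrite ler_wpM2l // lef_pV2 ?posrE // ler_nat.
  split=> [l /Q1/le_trans->//|i /Q2[y Py hy]].
  by exists y => // l; apply: le_trans (hy l) le.
have Qex m : exists x C, division x /\ Q m x C.
  pose pt (g : grid 'I_n m.+1) (i : 'I_n) : R := (gval g i)%:R * m.+1%:R^-1.
  have pt_div g : division (pt g).
    split=> [j|]; first by rewrite mulr_ge0.
    by rewrite -mulr_suml -natr_sum gval_sum divff.
  have /choice[c hc] : forall g, exists j, P (pt g) j by move=> g; apply: Pex.
  have [C [g [gC hC]]] := grid_labels (Ordinal n0) c.
  exists (pt g), C; split=> //; rewrite card_ord in gC hC; split=> [l /gC gl|i /hC[y cy hy]].
    by rewrite ler_wpM2r // ler_nat.
  exists (pt y) => [|l]; first by rewrite -cy.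
  have [h1 h2] := hy l.
  rewrite -mulrBl normrM (ger0_norm (x := _^-1)) // ler_wpM2r //.
  rewrite ler_norml; move: h1 h2; rewrite -!(ler_nat R) !natrD.
  by move=> h1 h2; apply/andP; split; lra.
have [x [C [ys [dx dys yx hQ]]]] := division_pigeonhole Qmono Qex.
have ys_cvg j : (fun m => ys m j) @ \oo --> x j.
  by apply: (@cvg_inv_bound _ _ 1) => m; rewrite mul1r.
exists x; split=> // j; have [jC|jC] := boolP (j \in C); [left|right].
  have /choice[z hz] : forall m, exists z, (division z /\ P z j) /\
      forall l, `|z l - ys m l| <= n%:R * m.+1%:R^-1.
    by move=> m; have [z hz1 hz2] := (hQ m).2 j jC; exists z.
  apply: (Pcl z) => // [m|l|m]; [exact: (hz m).1.1 | | exact: (hz m).1.2].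
  apply: (@cvg_inv_bound _ _ (n%:R + 1)) => m; rewrite mulrDl mul1r.
  apply: le_trans (ler_distD (ys m l) _ _) _; apply: lerD => //; exact: (hz m).2.
apply/eqP; rewrite eq_le dx.1 andbT.
have h0 : (fun m => n%:R * m.+1%:R^-1 : R) @ \oo --> (0 : R).
  by apply: (@cvg_inv_bound _ _ n%:R) => m; rewrite subr0 ger0_norm // mulr_ge0.
apply: (ler_cvg_to (ys_cvg j) h0).
by apply: nearW => m; exact: (hQ m).1.
Qed.

End Divisions.

(** * Fractional assignments *)

Section Nearness.
Variables (R : realType) (n : nat) (eps : R).
Hypothesis eps0 : 0 < eps.
Implicit Types (B : set ('I_n -> R)) (x y : 'I_n -> R).

(** Including [0] makes the supremum the larger of [0] and [eps] minus the distance to the divisions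
    in [B], and [0] if there are none. *)
Definition nearness_set B x : set R :=
  [set r | r = 0 \/ exists a, [/\ division a, B a & r = eps - dist1 x a]].

Definition nearness B x : R := sup (nearness_set B x).

Lemma dist1_ge0 x y : 0 <= dist1 x y.
Proof. exact: sumr_ge0. Qed.

Lemma nearness_ub B x r : nearness_set B x r -> r <= nearness B x.
Proof.
move=> Br; apply: ub_le_sup => //; exists eps => _ [->|[a [_ _ ->]]]; first exact: ltW.
by rewrite gerBl dist1_ge0.
Qed.

Lemma nearness_le B x r : 0 <= r ->
  (forall a, division a -> B a -> eps - dist1 x a <= r) -> nearness B x <= r.
Proof.
move=> r0 h; apply: ge_sup; first by exists 0; left.
by move=> _ [->//|[a [da Ba ->]]]; apply: h.
Qed.

Lemma nearness_ge0 B x : 0 <= nearness B x.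
Proof. by apply: nearness_ub; left. Qed.

Lemma nearness_mem B x : division x -> B x -> 0 < nearness B x.
Proof.
move=> dx Bx; apply: (lt_le_trans eps0); apply: nearness_ub; right; exists x; split=> //.
by rewrite /dist1 big1 ?subr0 // => l _; rewrite subrr normr0.
Qed.

Lemma nearness_gt0 B x : 0 < nearness B x ->
  exists a, [/\ division a, B a & dist1 x a < eps].
Proof.
move=> h; apply: contrapT => /forallNP no; move: h; apply/negP; rewrite -leNgt.
apply: nearness_le => // a da Ba; rewrite subr_le0 leNgt; apply/negP => lt.
by apply: (no a).
Qed.

Lemma nearness_lip B x y : nearness B x <= nearness B y + dist1 x y.
Proof.
apply: nearness_le => [|a da Ba]; first by rewrite addr_ge0 ?nearness_ge0 ?dist1_ge0.
have : eps - dist1 y a <= nearness B y by apply: nearness_ub; right; exists a.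
have : dist1 y a <= dist1 x y + dist1 x a.
  rewrite -big_split /=; apply: ler_sum => l _.
  by rewrite (distrC (x l) (y l)); apply: ler_distD.
lra.
Qed.

Lemma nearness_cvg B (ys : nat -> 'I_n -> R) x :
  (forall l, (fun m => ys m l) @ \oo --> x l) ->
  (fun m => nearness B (ys m)) @ \oo --> nearness B x.
Proof.
move=> yx.
have d0 : (fun m => dist1 (ys m) x) @ \oo --> (0 : R).
  have -> : 0 = \sum_(l < n) (0 : R) by rewrite big1.
  apply: (@cvgr_sum _ _ xpredT (fun l m => `|ys m l - x l|)) => l _.
  by apply/norm_cvg0P/subr_cvg0/yx.
apply/subr_cvg0/norm_cvg0P.
apply: (squeeze_cvgr _ (cvg_cst 0) d0); near=> m; rewrite normr_ge0 /=.
have := nearness_lip B (ys m) x; have := nearness_lip B x (ys m).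
have -> : dist1 x (ys m) = dist1 (ys m) x by apply: eq_bigr => l _; rewrite distrC.
by move=> h1 h2; rewrite ler_norml; apply/andP; split; lra.
Unshelve. all: by end_near.
Qed.

End Nearness.

Section Fractional.
Variables (R : realType) (n : nat) (T : finType) (S : {set T}).
Variable A : T -> ('I_n -> R) -> 'I_n -> Prop.
Hypothesis n0 : (0 < n)%N.
Hypothesis A_hungry : forall i x, division x -> exists j, A i x j /\ 0 < x j.
Hypothesis A_closed : forall i (xs : nat -> 'I_n -> R) x j,
  (forall m, division (xs m)) -> division x ->
  (forall l, (fun m => xs m l) @ \oo --> x l) ->
  (forall m, A i (xs m) j) -> A i x j.

Definition balanced (w : T -> 'I_n -> R) :=
  [/\ forall i j, 0 <= w i j, forall i, i \in S -> \sum_j w i j = 1 &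
      forall j, \sum_(i in S) w i j = #|S|%:R / n%:R].

(* The factor [x j] makes piece [j] get weight [0] when it is empty; this is
   what turns the alternative of [closed_labels] into [load x j <= #|S| / n]. *)
Lemma approx_balanced (eps : R) : 0 < eps ->
  exists x w, [/\ division x, balanced w &
    forall i j, 0 < w i j -> exists a, [/\ division a, A i a j & dist1 x a < eps]].
Proof.
move=> eps0.
pose s i j x := x j * nearness eps (fun a => A i a j) x.
pose D i x := \sum_j s i j x.
pose w x i j := s i j x / D i x.
pose load x j := \sum_(i in S) w x i j.
have s0 i j x : division x -> 0 <= s i j x.
  by move=> dx; rewrite mulr_ge0 ?nearness_ge0 // dx.1.
(* Hunger supplies a preferred piece of positive length, so the normalising sum is positive. *)
have D0 i x : division x -> 0 < D i x.
  move=> dx; have [j [Aj xj]] := A_hungry i dx.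
  rewrite /D (bigD1 j) //= ltr_pwDl //; last by rewrite sumr_ge0 // => l _; apply: s0.
  by rewrite mulr_gt0 // nearness_mem.
have w1 i x : division x -> \sum_j w x i j = 1.
  by move=> dx; rewrite -mulr_suml divff // gt_eqF // D0.
have load_sum x : division x -> \sum_j load x j = #|S|%:R.
  move=> dx; rewrite exchange_big /=; under eq_bigr do rewrite w1 //.
  by rewrite sumr_const.
have s_cvg i j (ys : nat -> 'I_n -> R) x : (forall l, (fun m => ys m l) @ \oo --> x l) ->
    (fun m => s i j (ys m)) @ \oo --> s i j x.
  by move=> yx; apply: cvgM; [exact: yx | exact: nearness_cvg].
have load_cvg j (ys : nat -> 'I_n -> R) x : division x ->
    (forall l, (fun m => ys m l) @ \oo --> x l) ->
    (fun m => load (ys m) j) @ \oo --> load x j.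
  move=> dx yx; apply: (@cvgr_sum _ _ _ (fun i m => w (ys m) i j)) => i _.
  apply: cvgM; first exact: s_cvg.
  apply: cvgV; first by rewrite gt_eqF // D0.
  by apply: (@cvgr_sum _ _ xpredT (fun j m => s i j (ys m))) => l _; apply: s_cvg.
have n0' : n%:R != 0 :> R by rewrite pnatr_eq0 -lt0n.
have sum_avg : \sum_(j < n) (#|S|%:R / n%:R) = #|S|%:R :> R.
  by rewrite sumr_const card_ord -[LHS]mulr_natr divfK.
have [x [dx hx]] : exists x, division x /\
    forall j, load x j <= #|S|%:R / n%:R \/ x j = 0.
  apply: (closed_labels (P := fun x j => load x j <= #|S|%:R / n%:R)) => //.
    (* The loads add up to [#|S|], so they cannot all exceed their average. *)
    move=> x dx; apply: contrapT => /forallNP no.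
    suff : #|S|%:R < #|S|%:R :> R by rewrite ltxx.
    rewrite -{2}(load_sum x dx) -{1}sum_avg; apply: ltr_sum.
      by apply/hasP; exists (Ordinal n0); rewrite ?mem_index_enum.
    by move=> j _; rewrite ltNge; apply/negP/no.
  move=> ys x j dys dx yx Pys.
  by apply: (cvgr_to_le (load_cvg j ys x dx yx)); apply: nearW.
have load_le j : load x j <= #|S|%:R / n%:R.
  have [//|xj] := hx j.
  by rewrite /load big1 ?divr_ge0 // => i _; rewrite /w /s xj !mul0r.
exists x, (w x); split=> //.
  split=> [i j|i _|j]; [|exact: w1|].
    by rewrite divr_ge0 ?s0 // ltW // D0.
  apply/eqP; move: (load_le j); rewrite le_eqVlt => /orP[//|lt].
  suff : #|S|%:R < #|S|%:R :> R by rewrite ltxx.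
  rewrite -{1}(load_sum x dx) -sum_avg (bigD1 j) //= [ltRHS](bigD1 j) //=.
  by rewrite ltr_leD // ler_sum.
move=> i j wij; apply: nearness_gt0.
rewrite lt_neqAle nearness_ge0 // andbT; apply: contraTneq wij => e.
by rewrite /w /s -e mulr0 mul0r ltxx.
Qed.

(** Only a set [P] containing the support, a finite datum, is followed to the limit. Its pairs are
    near-preferences at every level, hence preferences at [x] by closedness, and the weights are
    taken from a single level. *)
Lemma exists_balanced :
  exists x w, [/\ division x, balanced w & forall i j, 0 < w i j -> A i x j].
Proof.
pose Q m x (P : {set T * 'I_n}) :=
  (forall i j, (i, j) \in P -> exists a, [/\ division a, A i a j & dist1 x a < m.+1%:R^-1]) /\
  exists2 w, balanced w & forall i j, 0 < w i j -> (i, j) \in P.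
have [|m|x [P [ys [dx dys yx hQ]]]] := @division_pigeonhole R n {set T * 'I_n} Q.
- move=> m m' x P mm' [Q1 Q2]; split=> // i j /Q1[a [da Aa lt]].
  exists a; split=> //; apply: (lt_le_trans lt).
  by rewrite lef_pV2 ?posrE // ler_nat.
- have [|x [w [dx bw hw]]] := @approx_balanced (m.+1%:R^-1); first by [].
  exists x, [set ij | 0 < w ij.1 ij.2]%SET; split=> //; split=> [i j|].
    by rewrite inE; apply: hw.
  by exists w => // i j wij; rewrite inE.
have [_ [w bw wP]] := hQ 0%N.
exists x, w; split=> // i j /wP ijP.
have /choice[a ha] : forall m, exists a, [/\ division a, A i a j & dist1 (ys m) a < m.+1%:R^-1].
  by move=> m; exact: (hQ m).1.
apply: (A_closed (xs := a)) => // [m|l|m]; [by case: (ha m)| |by case: (ha m)].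
apply: (@cvg_inv_bound _ _ _ 2) => m; rewrite mulr_natl mulr2n.
apply: le_trans (ler_distD (ys m l) _ _) _; apply: lerD => //.
rewrite distrC; apply: le_trans (dist1_coord (ys m) (a m) l) _.
by apply: ltW; case: (ha m).
Qed.

End Fractional.

(** Double counting: the rows of [B] carry weight [a * #|B|], all of it in the columns of
    [nbhd r B], each holding at most [b]. *)
Lemma weight_le_nbhd (R : realType) (T U : finType) (A : {set T}) (w : T -> U -> R)
    (r : T -> U -> bool) (a b : R) :
  (forall t u, 0 <= w t u) -> (forall t u, 0 < w t u -> r t u) ->
  (forall t, t \in A -> \sum_u w t u = a) -> (forall u, \sum_(t in A) w t u <= b) ->
  forall B : {set T}, B \subset A -> a * #|B|%:R <= b * #|nbhd r B|%:R.
Proof.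
move=> w0 wr rows cols B BA.
have -> : a * #|B|%:R = \sum_(t in B) \sum_(u in nbhd r B) w t u.
  rewrite mulr_natr -sumr_const; apply: eq_bigr => t tB.
  rewrite -(rows t (fintype.subsetP BA t tB)) [LHS](bigID (mem (nbhd r B))) /=.
  rewrite [X in _ + X]big1 ?addr0 // => u uN; apply/eqP.
  rewrite eq_le w0 andbT leNgt; apply: contra uN => /wr rtu.
  by rewrite inE; apply/exists_inP; exists t.
rewrite exchange_big /= mulr_natr -sumr_const; apply: ler_sum => u _.
apply: le_trans (cols u); rewrite [leRHS](big_setID B) /= (finset.setIidPr BA).
by rewrite lerDl sumr_ge0.
Qed.

End Analysis.

(** * From fractional to envy-free assignments *)

Local Open Scope ring_scope.
Unset Implicit Arguments.
Set Strict Implicit.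

Theorem theorem2p3 (R : realType) (k : nat) (pref : preferences R k)
  (Hhungry : hungry pref) (Hclosed : closed_pref pref)
  (p q : nat) (Hp : (1 <= p <= k)%N) (Hq : (1 <= q <= k)%N) :
  (* (1) *)
  (forall S : {set 'I_k}, #|S| = p ->
     exists x : 'I_k -> R, division x /\
       forall Rm : {set 'I_k}, #|Rm| = ceil_div (k - p) p ->
         exists f : 'I_k -> 'I_k,
           {in S &, injective f} /\
           (forall i, i \in S -> f i \notin Rm /\ pref k i x (f i)))
  /\
  (* (2) *)
  (exists x : 'I_q -> R, division x /\
     forall L : {set 'I_k}, #|L| = ceil_div (k - q) q ->
       exists g : 'I_q -> 'I_k,
         injective g /\ (forall j : 'I_q, g j \notin L /\ pref q (g j) x j)).
Proof.
have k0 : (0 < k)%N by lia.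
have kR : 0 < k%:R :> R by rewrite ltr0n.
split.
  move=> S cS.
  have [x [w [dx [w0 rows cols] wp]]] :=
    @exists_balanced R k 'I_k S (pref k) k0 (Hhungry k) (Hclosed k).
  exists x; split=> // Rm cR.
  pose r i j := `[< pref k i x j >].
  have [|f [injf hf]] := @hall_robust _ _ (Ordinal k0) r S p k Rm Hp _ cR.
    move=> B BS; rewrite -(ler_nat R) !natrM.
    have := @weight_le_nbhd _ _ _ S w r 1 (p%:R / k%:R) w0 _ rows _ B BS.
    rewrite mul1r mulrAC ler_pdivlMr // [_ * k%:R]mulrC; apply; last by move=> j; rewrite cols cS.
    by move=> i j /wp h; apply/asboolP.
  by exists f; split=> // i /hf[? /asboolP].
have q0 : (0 < q)%N by lia.
have qR : 0 < q%:R :> R by rewrite ltr0n.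
have [x [w [dx [w0 rows cols] wp]]] :=
  @exists_balanced R q 'I_k [set: 'I_k] (pref q) q0 (Hhungry q) (Hclosed q).
exists x; split=> // L cL.
(* The roles are swapped: pieces become rows of sum [k / q], and players become columns of sum
   [1]. *)
pose r j i := `[< pref q i x j >].
have [|g [injg hg]] := @hall_robust _ _ (Ordinal k0) r [set: 'I_q] q k L Hq _ cL.
  move=> B BS; rewrite -(ler_nat R) !natrM.
  have := @weight_le_nbhd _ _ _ [set: 'I_q] (fun j i => w i j) r (k%:R / q%:R) 1
    _ _ _ _ B BS.
  rewrite mul1r mulrAC ler_pdivrMr // [_ * q%:R]mulrC; apply=> //.
  - by move=> j i /wp h; apply/asboolP.
  - move=> j _; have := cols j; rewrite cardsT card_ord => <-.
    by apply: eq_bigl => i; rewrite inE.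
  move=> i; rewrite -(rows i) ?inE //.
  by under eq_bigl do rewrite inE.
exists g; split; first by move=> i j; apply: injg; rewrite inE.
by move=> j; have [|? /asboolP] := hg j; rewrite ?inE.
Qed.
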